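(* Let $k\in\{2,3\}$. Suppose a normalised closed chain of Ford circles corresponds to a $k$-multiflipative triangulated polygon. Let $\lambda=1/k$ if the vertex $\infty$ is incident to internal diagonals of polygons from the partition provided by multiflipativity, or $\lambda=k$ otherwise. Then rescaling the chain by the factor of $\lambda$ and then applying the Möbius transformation $z\mapsto\lambda z$ gives the normalised chain of Ford circles that corresponds to the multiflipped polygon.
   Context: Triangulated polygons: a convex polygon with $N\ge3$ vertices labelled clockwise by $0,1,\dots,N-1$, with a triangulation by non-crossing diagonals. 2-multiflipative: the triangulated polygon can be partitioned (along diagonals of the triangulation) into triangulated quadrilaterals such that the vertices around the polygon alternate between those incident to a diagonal of a quadrilateral (the triangulation diagonal inside a quadrilateral of the partition) and those that are not. The multiflip preserves the quadrilaterals and replaces the diagonal within each by the other possible diagonal. 3-multiflipative: the triangulated polygon can be partitioned (along diagonals of the triangulation) into triangulated hexagons, each having an internal triangle (formed by three diagonals of the hexagon), such that the vertices around the polygon alternate between those incident to a diagonal in a hexagon (a side of an internal triangle) and those that are not. The multiflip preserves the hexagons and replaces the internal triangle within each by the other possible internal triangle. The ''internal diagonals of polygons from the partition'' are the triangulation diagonals inside the quadrilaterals ($k=2$), or the sides of the internal triangles of the hexagons ($k=3$). Multiflips keep vertex labels. The Farey graph $\mathscr{F}$ has vertices the reduced rationals together with $\infty=1/0$, with an edge between $a/b$ and $c/d$ exactly when $ad-bc=\pm1$; edges are represented by hyperbolic lines in the upper half-plane, giving the Farey tessellation by ideal triangles. A simple closed clockwise path (clockwise being the direction in which real numbers decrease)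 of length $N$ in $\mathscr{F}$ encloses a triangulated $N$-gon, whose triangulation is formed by Farey edges. The path with vertices $a_0/b_0,\dots,a_{N-1}/b_{N-1}$ (indices matching the polygon's labels) is normalised if $a_0/b_0=1/0$ and $a_{N-1}/b_{N-1}=0/1$. Every triangulated labelled $N$-gon is enclosed by exactly one normalised path. The Ford circle at a reduced rational $a/b$ is the horocycle of Euclidean diameter $1/b^2$ tangent to the real line at $a/b$ (its centre, as a horocycle); the Ford circle at $\infty$ is $\{\operatorname{Im} z=1\}$. The normalised closed chain of Ford circles corresponding to a triangulated polygon is $(F_0,\dots,F_{N-1})$, where $F_i$ is the Ford circle at the $i$th vertex of the normalised path enclosing the polygon. Rescaling of a horocycle centred at a real number by a factor of $\lambda>0$ gives the horocycle with the same centre and Euclidean radius multiplied by $\lambda$; for a horocycle $\{\operatorname{Im} z=h\}$ centred at $\infty$ it gives $\{\operatorname{Im} z=h/\lambda\}$. For a closed chain of tangent horocycles $(H_0,\dots,H_{N-1})$ with $N$ even (cyclically consecutive horocycles tangent), rescaling by a factor of $\lambda$ means rescaling each $H_i$ by a factor of $\lambda^{(-1)^i}$. *)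

(* Defs.v *)
From mathcomp Require Import all_boot all_order all_algebra.
From mathcomp Require Import boolp classical_sets reals.
From mathcomp Require Import complex.

Set Implicit Arguments.
Unset Strict Implicit.
Unset Printing Implicit Defensive.

Import Order.TTheory GRing.Theory Num.Theory.

Local Open Scope ring_scope.

Section Polygons.

Variable N : nat.
Implicit Types (d : {set 'I_N}) (A Q t : {set 'I_N}) (T D : {set {set 'I_N}}).

(* The vertices of the convex N-gon are 0, ..., N-1 in this cyclic order. A   *)
(* set Q of vertices stands for the convex polygon that it spans, and a chord *)
(* is a pair of vertices. The line through a chord d = {a, b} with a < b cuts *)
(* the remaining vertices into those x with a < x < b and the others.         *)
Definition chords A : {set {set 'I_N}} :=
  [set d : {set 'I_N} | (d \subset A) && (#|d| == 2)].

Definition between d (x : 'I_N) : bool :=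
  [exists a in d, exists b in d, (a < x < b)%N].

Definition beyond d (x : 'I_N) : bool := (x \notin d) && ~~ between d x.

(* A has vertices strictly on both sides of the chord d; when A is itself a   *)
(* chord, this says that d and A cross.                                       *)
Definition separates d A : bool :=
  [exists x in A, between d x] && [exists x in A, beyond d x].

Definition diagonals Q : {set {set 'I_N}} :=
  [set d in chords Q | separates d Q].

Definition sides Q : {set {set 'I_N}} := chords Q :\: diagonals Q.

Definition noncrossing T : bool :=
  (T \subset diagonals [set: 'I_N]%SET) &&
  [forall d in T, forall e in T, ~~ separates d e].

Definition triangulation T : bool := maxset noncrossing T.

(* Q is one of the polygons obtained by cutting the N-gon along D. *)
Definition piece D Q : bool :=
  [&& (2 < #|Q|)%N,
      sides Q \subset sides [set: 'I_N]%SET :|: D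
    & [disjoint diagonals Q & D]].

(* For a 2k-gon Q with k = 2, t is the pair of endpoints of a diagonal of Q;  *)
(* with k = 3, it is the set of vertices of an internal triangle of Q. In     *)
(* each case there are exactly two such t, and chords t consists of the       *)
(* diagonal, respectively of the three sides of the triangle.                 *)
Definition inner (k : nat) Q t : bool :=
  [&& t \subset Q, #|t| == k & chords t \subset diagonals Q].

Definition internal_diagonals (k : nat) T D : {set {set 'I_N}} :=
  \bigcup_(Q | piece D Q)
    \bigcup_(t | inner k Q t && (chords t \subset T)) chords t.

Definition incident (k : nat) T D (i : 'I_N) : bool :=
  [exists d in internal_diagonals k T D, i \in d].

(* Cutting T along D is a partition as required of a k-multiflipative         *)
(* triangulated polygon.                                                      *)
Definition multiflip_partition (k : nat) T D : Prop :=
  [/\ D \subset T,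
      forall Q, piece D Q ->
        #|Q| = (2 * k)%N /\ exists2 t, inner k Q t & chords t \subset T
    & forall i : 'I_N, incident k T D (ordS i) = ~~ incident k T D i].

Definition multiflip (k : nat) T D : {set {set 'I_N}} :=
  D :|: \bigcup_(Q | piece D Q)
          \bigcup_(t | inner k Q t && ~~ (chords t \subset T)) chords t.

End Polygons.

(* Vertices of the Farey graph: Some q is the reduced rational q, and None is *)
(* infinity = 1/0.                                                            *)
Definition farey : Type := option rat.

Definition fnum (x : farey) : int := if x is Some q then numq q else 1.
Definition fden (x : farey) : int := if x is Some q then denq q else 0.

Definition farey_edge (x y : farey) : bool :=
  `|fnum x * fden y - fnum y * fden x| == 1.

Definition farey_gt (x y : farey) : bool :=
  match x, y with
  | Some p, Some q => q < p
  | None, Some _ => true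
  | _, None => false
  end.

(* Moving clockwise the reals decrease, down to infinity, and then decrease   *)
(* again from infinity; so x, y, z are met in this order if they are          *)
(* decreasing, with infinity as greatest element, up to a cyclic permutation. *)
Definition clockwise (x y z : farey) : bool :=
  [|| farey_gt x y && farey_gt y z,
      farey_gt y z && farey_gt z x
    | farey_gt z x && farey_gt x y].

Definition simple_closed_clockwise_path (N : nat) (v : 'I_N -> farey) : Prop :=
  [/\ injective v,
      forall i, farey_edge (v i) (v (ordS i))
    & forall i j l : 'I_N, (i < j < l)%N -> clockwise (v i) (v j) (v l)].

Definition enclosed_triangulation (N : nat) (v : 'I_N -> farey) :
    {set {set 'I_N}} :=
  [set d in diagonals [set: 'I_N]%SET |
    [forall i in d, forall j in d, (i != j) ==> farey_edge (v i) (v j)]].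

Definition normalised (n : nat) (v : 'I_n.+1 -> farey) : Prop :=
  v ord0 = None /\ v ord_max = Some 0.

Section Horocycles.

Variable R : realType.

Local Open Scope complex_scope.

(* HoroReal c r is the horocycle of Euclidean radius r > 0 centred at the     *)
(* real number c; HoroInfty h is the line Im z = h, with h > 0.               *)
Inductive horocycle : Type :=
  | HoroReal of R & R
  | HoroInfty of R.

(* The points of a horocycle, in the open upper half-plane; in particular the *)
(* point of tangency with the real line is excluded.                          *)
Definition horo_points (H : horocycle) : set R[i] :=
  match H with
  | HoroReal c r =>
      [set z : R[i] | 0 < complex.Im z /\ `|z - (c +i* r)| = r%:C]%classic
  | HoroInfty h => [set z : R[i] | complex.Im z = h]%classic
  end.

Definition rescale (lam : R) (H : horocycle) : horocycle :=
  match H with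
  | HoroReal c r => HoroReal c (lam * r)
  | HoroInfty h => HoroInfty (h / lam)
  end.

Definition rescale_chain (N : nat) (lam : R) (H : 'I_N -> horocycle) :
    'I_N -> horocycle :=
  fun i => rescale (lam ^ ((-1 : int) ^+ i)) (H i).

(* The radius is half of the diameter 1 / b ^ 2. *)
Definition ford_circle (x : farey) : horocycle :=
  if x is Some q then HoroReal (ratr q) (((denq q)%:~R ^+ 2)^-1 / 2)
  else HoroInfty 1.

(* F is the normalised closed chain of Ford circles corresponding to the      *)
(* triangulated polygon T.                                                    *)
Definition normalised_ford_chain (n : nat) (T : {set {set 'I_n.+1}})
    (F : 'I_n.+1 -> horocycle) : Prop :=
  exists v : 'I_n.+1 -> farey,
    [/\ simple_closed_clockwise_path v, normalised v,
        T = enclosed_triangulation v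
      & forall i, F i = ford_circle (v i)].

(* The image of a subset of the plane under z |-> lam * z. *)
Definition mobius_scale (lam : R) (S : set R[i]) : set R[i] :=
  [set lam%:C * z | z in S]%classic.

End Horocycles.

(* Main.v *)
Require Import Defs.
From mathcomp Require Import all_boot all_order all_algebra.
From mathcomp Require Import boolp classical_sets reals.
From mathcomp Require Import complex.
From mathcomp Require Import zify ring.

(* Write the Farey vertices as vectors (num, den). Along a normalised path    *)
(* the determinant of an earlier with a later vertex is positive, and it is 1 *)
(* exactly for Farey neighbours. In a piece of the partition the sides and    *)
(* the inner chords have determinant 1, so the Pluecker relation gives        *)
(* determinant k for any two non-incident vertices (and 2 for the long        *)
(* diagonals of a hexagon). Passing from piece to piece across the partition, *)
(* all non-incident vertices have pairwise determinants divisible by k; one   *)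
(* of them is infinity or 0, so k divides all their denominators,             *)
(* respectively all their numerators. Hence z |-> lam z divides the           *)
(* determinants of non-incident pairs by k, multiplies those of incident      *)
(* pairs by k and preserves the mixed ones: the determinants equal to 1 after *)
(* scaling are those of the sides, of the cuts and of the flipped chords.     *)
(* The same computation of reduced fractions matches the radii of the Ford    *)
(* circles.                                                                   *)

Set Implicit Arguments.
Unset Strict Implicit.
Unset Printing Implicit Defensive.

Import Order.TTheory GRing.Theory Num.Theory.

Local Open Scope ring_scope.

(** * Chords and pieces *)

Section Polygon.

Variable N : nat.
Implicit Types (a b c e x y z : 'I_N) (A Q d t : {set 'I_N}).
Implicit Types (T D : {set {set 'I_N}}).

(** The whole statement is reduced to the integer determinants [fdet] of reduced fractions. Inside
    one piece, [piece_geometry] computes the relevant determinants from the Plücker relation.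
    [bond_alternate] carries this from piece to piece: divisibility of determinants by [k] is
    transitive, because reduced fractions are primitive vectors ([dvdz_fdet_trans]). Infinity and 0
    are adjacent vertices, so exactly one of them is non-incident, and determinants with it are, up
    to sign, denominators or numerators; this gives [nonincident_dvd].

    Consequently the reduced form of each scaled vertex is known ([flip_fraction]), and so are all
    determinants of the scaled path. For [multiflip_enclosed], the cuts keep determinant 1 and Farey
    edges do not cross, so an edge of the scaled path is a polygon side, a cut or a diagonal of a
    piece ([diagonal_in_piece]); within a piece only the flipped chords have determinant 1.

    For the circles, the new denominator is the old one at odd labels and is divided by the scaling
    factor at even labels, which is the alternating exponent of [rescale_chain]. *)

Lemma mem_chords A x y :
  ([set x; y]%SET \in chords A) = [&& x \in A, y \in A & x != y].
Proof.
rewrite inE finset.subUset !finset.sub1set cards2.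
by case: (x \in A); case: (y \in A); case: (x == y).
Qed.

Lemma chordsP A d :
  reflect (exists x y, [/\ (x < y)%N, x \in A, y \in A & d = [set x; y]%SET])
          (d \in chords A).
Proof.
apply: (iffP idP); last first.
  by move=> [x [y [xy xA yA ->]]]; rewrite mem_chords xA yA -val_eqE /=; lia.
move=> dA; have /cards2P[x [y [xy def_d]]] : #|d| == 2.
  by move: dA; rewrite inE => /andP[].
move: dA; rewrite def_d mem_chords => /and3P[xA yA _].
have [lt_xy|] := boolP (x < y)%N; first by exists x, y.
rewrite -leqNgt leq_eqVlt val_eqE eq_sym (negPf xy) /= => lt_yx.
by exists y, x; rewrite finset.setUC.
Qed.

Lemma between2 a b x : (a < b)%N -> between [set a; b]%SET x = (a < x < b)%N.
Proof.
move=> ab; apply/existsP/idP => [[c /andP[]]|xab].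
  rewrite !inE => /orP[]/eqP-> /existsP[e /andP[]];
  rewrite !inE => /orP[]/eqP->; lia.
exists a; rewrite !inE eqxx /=; apply/existsP; exists b.
by rewrite !inE eqxx orbT.
Qed.

Lemma beyond2 a b x :
  (a < b)%N -> beyond [set a; b]%SET x = (x < a)%N || (b < x)%N.
Proof. by move=> ab; rewrite /beyond between2 // !inE -!val_eqE /=; lia. Qed.

Lemma separates2P a b A : (a < b)%N ->
  reflect ((exists2 x, x \in A & (a < x < b)%N) /\
           (exists2 x, x \in A & (x < a)%N || (b < x)%N))
          (separates [set a; b]%SET A).
Proof.
move=> ab; apply: (iffP andP) => -[].
  move=> /existsP[x /andP[xA xab]] /existsP[y /andP[yA yab]].
  by split; [exists x; rewrite -?between2|exists y; rewrite -?beyond2].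
move=> [x xA xab] [y yA yab]; split; apply/existsP.
  by exists x; rewrite xA between2.
by exists y; rewrite yA beyond2.
Qed.

Lemma diagonals2 a b A : (a < b)%N -> ([set a; b]%SET \in diagonals A) =
  [&& a \in A, b \in A & separates [set a; b]%SET A].
Proof.
by move=> ab; rewrite inE mem_chords -val_eqE neq_ltn ab /= andbT andbA.
Qed.

Lemma diagonals_sub Q : diagonals Q \subset chords Q.
Proof. by apply/fintype.subsetP => d; rewrite inE => /andP[]. Qed.

Lemma diagonals_mono Q A : Q \subset A -> diagonals Q \subset diagonals A.
Proof.
move=> /fintype.subsetP QA; apply/fintype.subsetP => d.
rewrite [d \in _]inE => /andP[/chordsP[x [y [xy xQ yQ ->]]]].
move=> /(separates2P _ xy)[[u uQ u_xy] [z zQ z_xy]].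
rewrite inE mem_chords !QA //= -val_eqE neq_ltn xy /=.
by apply/separates2P => //; split; [exists u|exists z]; rewrite ?QA.
Qed.

Lemma noncrossing_cross D a b c e :
  noncrossing D -> [set a; b]%SET \in D -> [set c; e]%SET \in D ->
  ~~ ((a < c < b)%N && (b < e)%N).
Proof.
move=> /andP[_ /forall_inP ncD] abD ceD; apply/negP => abce.
have /forall_inP/(_ _ ceD)/negP := ncD _ abD; apply.
apply/separates2P; first by lia.
by split; [exists c|exists e]; rewrite ?inE ?eqxx ?orbT //; lia.
Qed.

(* A chord that bounds a region of the polygon cut along D on the side of the *)
(* vertices between its ends. *)
Definition gate D a b : bool :=
  ([set a; b]%SET \in D) || ((a == 0 :> nat) && (b.+1 == N)).

(* The piece adjacent to the chord {a, b} on the side between a and b. *)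
Definition piece_below D a b : {set 'I_N} :=
  [set x : 'I_N | (a <= x <= b)%N &
     [forall c, forall e, [&& [set c; e]%SET \in D, (a <= c)%N, (e <= b)%N
                            & (c, e) != (a, b)] ==> ~~ (c < x < e)%N]]%SET.

Lemma piece_belowP D a b x :
  reflect ((a <= x <= b)%N /\ forall c e, [set c; e]%SET \in D -> (a <= c)%N ->
             (e <= b)%N -> (c, e) != (a, b) -> ~~ (c < x < e)%N)
          (x \in piece_below D a b).
Proof.
rewrite inE; apply: (iffP andP) => -[-> h]; split=> //.
  move=> c e ceD ac eb neq; move: h => /forallP/(_ c)/forallP/(_ e).
  by rewrite ceD ac eb neq.
apply/forallP => c; apply/forallP => e; apply/implyP => /and4P[*].
exact: h.
Qed.

(** If [x + 1] is missing from the piece, some chord of [D] covers it; as that chord does not cover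
    [x], it starts at [x]. The far end of the longest such chord is covered by nothing, since chords
    do not cross, so it is the next vertex of the piece. *)
Lemma piece_below_next D a b x y : noncrossing D ->
  x \in piece_below D a b -> y \in piece_below D a b -> (x < y)%N ->
  (forall z, z \in piece_below D a b -> ~~ (x < z < y)%N) ->
  y = x.+1 :> nat \/ [set x; y]%SET \in D /\ (x, y) != (a, b).
Proof.
move=> ncD xQ yQ xy gap.
have [|xy1] := eqVneq (y : nat) x.+1; [by left|right].
have [/andP[ax xb] xcov] := piece_belowP _ _ _ _ xQ.
have [/andP[ay yb] ycov] := piece_belowP _ _ _ _ yQ.
pose P e := [&& [set x; e]%SET \in D, (x.+1 < e <= b)%N & (x, e) != (a, b)].
have [e0 Pe0] : exists e, P e.
  have ltx1 : (x.+1 < N)%N by apply: leq_ltn_trans (ltn_ord y).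
  have : Ordinal ltx1 \notin piece_below D a b.
    by apply/negP => /gap /=; lia.
  rewrite inE /= negb_and => /orP[|/forallPn[c /forallPn[e]]]; first by lia.
  rewrite negb_imply negbK => /andP[/and4P[ceD ac eb neq] /= ce].
  have cx : c = x.
    apply: val_inj => /=; have := xcov c e ceD ac eb neq; lia.
  by exists e; rewrite /P -cx ceD neq eb cx andbT; lia.
pose e := [arg max_(e > e0 | P e) val e].
have [Pe emax] : P e /\ forall e', P e' -> (e' <= e)%N.
  by rewrite /e; case: arg_maxnP.
have /and3P[xeD /andP[xe eb] neq] := Pe.
have eQ : e \in piece_below D a b.
  apply/piece_belowP; split; first by lia.
  move=> c e' ceD ac e'b neq'; apply/negP => cee'.
  have nc := noncrossing_cross ncD xeD ceD.
  have xc := xcov _ _ ceD ac e'b neq'.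
  have cx : c = x by apply: val_inj => /=; lia.
  have := emax e'; rewrite /P -cx ceD neq' e'b andbT /= cx; lia.
have ye := gap e eQ.
have ey := ycov _ _ xeD ax eb neq.
have -> : y = e by apply: val_inj => /=; lia.
by split.
Qed.

Lemma piece_below_ends D a b :
  (a <= b)%N -> (a \in piece_below D a b) && (b \in piece_below D a b).
Proof.
by move=> ab; apply/andP; split; apply/piece_belowP; split=> *; lia.
Qed.

(** By [piece_below_next], the sides of the region are steps of the polygon, cuts, or the gate
    itself; a cut that was a diagonal of the region would cover one of its vertices. *)
Lemma piece_piece_below D a b : noncrossing D -> gate D a b ->
  (a.+1 < b)%N -> piece D (piece_below D a b).
Proof.
move=> ncD gab ab; set Q := piece_below D a b.
have /andP[aQ bQ] : (a \in Q) && (b \in Q) by apply: piece_below_ends; lia.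
apply/and3P; split.
- have /existsP[z /andP[zQ zab]] : [exists z, (z \in Q) && (a < z < b)%N].
    apply: contraPT isT => /existsPn gap.
    have [||ab1|[_ /eqP//]] := @piece_below_next D a b a b ncD aQ bQ.
    + by lia.
    + by move=> z zQ; have := gap z; rewrite zQ.
    + by lia.
  rewrite (cardsD1 a) aQ (cardsD1 b) finset.in_setD1 bQ (cardsD1 z) !finset.in_setD1 zQ.
  by rewrite -!val_eqE /=; lia.
- apply/fintype.subsetP => d; rewrite inE [d \in diagonals _]inE => /andP[sepN dQ].
  move: sepN; rewrite dQ /=; move/chordsP: dQ => [x [y [xy xQ yQ ->]]] sepN.
  rewrite finset.in_setU finset.in_setD diagonals2 // mem_chords !finset.in_setT.
  rewrite -val_eqE neq_ltn xy /= andbT.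
  (* A side with a vertex of [Q] beneath it has none beyond it, so it spans from [a] to [b] and is
     the gate. *)
  have [/existsP[z /andP[zQ zxy]]|/existsPn gap] :=
    boolP [exists z, (z \in Q) && (x < z < y)%N].
    have [/andP[ax _] _] := piece_belowP _ _ _ _ xQ.
    have [/andP[_ yb] _] := piece_belowP _ _ _ _ yQ.
    have out u : u \in Q -> ~~ ((u < x)%N || (y < u)%N).
      move=> uQ; apply: contraNN sepN => u_xy.
      by apply/separates2P => //; split; [exists z|exists u].
    have [ea eb] : x = a /\ y = b.
      by split; apply: val_inj => /=; have := out _ aQ; have := out _ bQ; lia.
    move: gab; rewrite /gate -ea -eb => /orP[->|/andP[/eqP x0 /eqP yN]]; rewrite ?orbT //.
    apply/orP; left; apply/negP => /separates2P-/(_ xy)[_ [u _]].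
    by have := ltn_ord u; lia.
  have [|xy1|[-> _]] := piece_below_next ncD xQ yQ xy; last by rewrite orbT.
    by move=> z zQ; have := gap z; rewrite zQ.
  by apply/orP; left; apply/negP => /separates2P-/(_ xy)[[u _]]; lia.
- rewrite finset.disjoints_subset; apply/fintype.subsetP => d.
  rewrite inE => /andP[/chordsP[x [y [xy xQ yQ ->]]]].
  move=> /(separates2P _ xy)[[u uQ u_xy] [z zQ z_xy]].
  rewrite finset.in_setC; apply/negP => xyD.
  have [/andP[ax _] _] := piece_belowP _ _ _ _ xQ.
  have [/andP[_ yb] _] := piece_belowP _ _ _ _ yQ.
  have [zab _] := piece_belowP _ _ _ _ zQ.
  have [_ /(_ x y xyD ax yb)] := piece_belowP _ _ _ _ uQ.
  rewrite u_xy => /(_ _)/negP; apply=> //.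
  by apply/eqP => -[? ?]; subst; lia.
Qed.

(** Among the gates that span [x] and [y], a shortest one works: no cut below it can cover [x] or
    [y], for it would either cross the diagonal or be a shorter gate. The closing side from 0 to
    [N - 1] guarantees that there is a gate at all. *)
Lemma diagonal_in_piece D x y : noncrossing D ->
  [set x; y]%SET \in diagonals [set: 'I_N]%SET -> (x < y)%N ->
  (forall a b, [set a; b]%SET \in D -> ~~ ((a < x < b)%N && (b < y)%N) /\ ~~ ((x < a < y)%N && (y < b)%N)) ->
  [set x; y]%SET \in D \/
  exists2 Q, piece D Q & [set x; y]%SET \in diagonals Q.
Proof.
move=> ncD dxy xy ncxy; have [|xyD] := boolP (_ \in D); [by left|right].
pose P (p : 'I_N * 'I_N) := [&& gate D p.1 p.2, (p.1 <= x)%N & (y <= p.2)%N].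
have [p0 Pp0] : exists p, P p.
  have lt0 : (0 < N)%N by apply: leq_ltn_trans (ltn_ord x).
  have lt1 : (N.-1 < N)%N by rewrite prednK.
  exists (Ordinal lt0, Ordinal lt1); rewrite /P /gate /= prednK // eqxx orbT /=.
  by have := ltn_ord y; lia.
pose p := [arg min_(p < p0 | P p) (p.2 - p.1)%N].
have [Pp pmin] : P p /\ forall q, P q -> (p.2 - p.1 <= q.2 - q.1)%N.
  by rewrite /p; case: arg_minnP.
clearbody p; case: p Pp pmin => a b /= /and3P[/= gab ax yb] pmin.
have neq : (x == a) && (y == b) = false.
  apply: contraNF xyD => /andP[/eqP exa /eqP eyb]; subst.
  move: gab => /orP[//|/andP[/eqP a0 /eqP bN]].
  move: dxy; rewrite inE => /andP[_ /separates2P-/(_ xy)[_ [u _]]].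
  by have := ltn_ord u; lia.
rewrite -!val_eqE /= in neq.
have mem z : (z == x) || (z == y) -> z \in piece_below D a b.
  move=> zxy; apply/piece_belowP; split.
    by case/orP: zxy => /eqP->; lia.
  move=> c e ceD ac eb; rewrite xpair_eqE -!val_eqE /= => ne; apply/negP => cze.
  have [nc1 nc2] := ncxy _ _ ceD.
  have := pmin (c, e); rewrite /P /gate ceD /=.
  by case/orP: zxy => /eqP zE; subst; lia.
have [xQ yQ] : x \in piece_below D a b /\ y \in piece_below D a b.
  by split; apply: mem; rewrite eqxx ?orbT.
have pQ : piece D (piece_below D a b) by apply: piece_piece_below => //; lia.
exists (piece_below D a b) => //; apply: contraT => nd.
have /and3P[_ /fintype.subsetP/(_ [set x; y]%SET) sides_sub _] := pQ.
move: sides_sub; rewrite finset.in_setD nd mem_chords xQ yQ -val_eqE neq_ltn xy /=.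
by move=> /(_ isT); rewrite finset.in_setU (negPf xyD) orbF finset.in_setD dxy.
Qed.

End Polygon.

(** * Vertices of a piece listed in increasing order *)

Section Enumeration.

Variables (N m : nat) (Q : {set 'I_N}) (q : nat -> 'I_N).

(** The last clause turns the size of a subset of [Q] into a sum of booleans over indices, which is
    how inner diagonals and triangles are counted. *)
Definition enumerates : Prop :=
  [/\ forall i j, (i < j < m)%N -> (q i < q j)%N,
      forall i, (i < m)%N -> q i \in Q,
    forall x, x \in Q -> exists2 i, (i < m)%N & x = q i
    & forall P : pred 'I_N, #|[set x in Q | P x]%SET| = (\sum_(i < m) P (q i))%N].

Hypothesis enumQ : enumerates.

Lemma enum_in i : (i < m)%N -> q i \in Q.
Proof. by case: enumQ => _ memQ _ _; apply: memQ. Qed.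

Lemma enum_lt i j : (i < m)%N -> (j < m)%N -> (q i < q j)%N = (i < j)%N.
Proof.
case: enumQ => lt_q _ _ _ im jm; case: (ltngtP i j) => [ij|ji|->].
- by rewrite lt_q // ij.
- by have := lt_q j i; rewrite ji im => /(_ isT); lia.
- by rewrite ltnn.
Qed.

Lemma enum_diagonals i j : (i < j < m)%N ->
  ([set q i; q j]%SET \in diagonals Q) = (i.+1 < j)%N && (j - i < m.-1)%N.
Proof.
move=> ijm; have [im jm] : (i < m)%N /\ (j < m)%N by lia.
have [_ _ memQ _] := enumQ.
have qij : (q i < q j)%N by rewrite enum_lt //; lia.
rewrite diagonals2 // !enum_in //=.
apply/(separates2P _ qij)/andP => [[[x /memQ[l lm ->]]]|[ij1 jim]].
  rewrite !enum_lt // => l_ij [y /memQ[p pm ->]].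
  by rewrite !enum_lt // => p_ij; split; lia.
split; first by exists (q i.+1); [apply: enum_in|rewrite !enum_lt]; lia.
have [i0|i0] := posnP i.
  by exists (q j.+1); [apply: enum_in|rewrite !enum_lt]; lia.
by exists (q i.-1); [apply: enum_in|rewrite !enum_lt]; lia.
Qed.

End Enumeration.

Lemma enumerate N m (Q : {set 'I_N}) :
  #|Q| = m.+1 -> exists q, enumerates m.+1 Q q.
Proof.
move=> cardQ.
have [x0 _] : exists x0, x0 \in Q by apply/set0Pn; rewrite -card_gt0 cardQ.
have szQ : size (enum Q) = m.+1 by rewrite -cardE.
have ltn_tr : transitive (fun x y : 'I_N => (x < y)%N).
  by move=> y x z; apply: ltn_trans.
have sortedQ : sorted (fun x y : 'I_N => (x < y)%N) (enum Q).
  rewrite /enum_mem; apply: sorted_filter => //.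
  have := iota_ltn_sorted 0 N; rewrite -val_enum_ord sorted_map.
  by rewrite enumT.
exists (nth x0 (enum Q)); split.
- move=> i j /andP[ij jm].
  by apply: (sorted_ltn_nth ltn_tr x0 sortedQ) => //; rewrite inE szQ; lia.
- by move=> i im; rewrite -mem_enum mem_nth ?szQ.
- move=> x; rewrite -mem_enum => xQ; exists (index x (enum Q)).
    by rewrite -szQ index_mem.
  by rewrite nth_index.
- move=> P; transitivity (\sum_(x in Q) P x)%N.
    rewrite -sum1_card big_mkcond [RHS]big_mkcond; apply: eq_bigr => x _.
    by rewrite inE; case: (x \in Q); case: (P x).
  by rewrite -big_enum /= (big_nth x0) szQ big_mkord.
Qed.

(** No two cyclically adjacent vertices of [Q] are both in [t], and [k] such vertices among [2 * k]
    must alternate; the boolean [b] tells whether [q 0] is in [t]. The alternation is checked on all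
    truth assignments. *)
Lemma inner_enum N k (Q t : {set 'I_N}) q :
  k = 2%N \/ k = 3%N -> enumerates (2 * k) Q q -> inner k Q t ->
  exists b, forall i, (i < 2 * k)%N -> (q i \in t) = (odd i (+) b).
Proof.
move=> hk enQ /and3P[tQ /eqP card_t chords_t].
have nadj i j : (i < j < 2 * k)%N -> ~~ ((i.+1 < j)%N && (j - i < (2 * k).-1)%N) ->
  ~~ ((q i \in t) && (q j \in t)).
  move=> ij; apply: contraNN => /andP[ti tj].
  rewrite -(enum_diagonals enQ) // (fintype.subsetP chords_t) //.
  have qij : (q i < q j)%N by rewrite (enum_lt enQ); lia.
  by rewrite mem_chords ti tj -val_eqE neq_ltn qij.
have [_ _ _ /(_ (mem t))] := enQ.
have -> : [set x in Q | mem t x]%SET = t.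
  apply/setP => x; rewrite inE /= andb_idl //; exact: (fintype.subsetP tQ).
rewrite card_t /=.
case: hk => ->  in nadj *; rewrite !big_ord_recl big_ord0 /= /bump /= !add1n.
  have := nadj 0%N 1%N isT isT; have := nadj 1%N 2%N isT isT.
  have := nadj 2%N 3%N isT isT; have := nadj 0%N 3%N isT isT => h1 h2 h3 h4 hs.
  exists (q 0%N \in t); case=> [|[|[|[|//]]]] _;
  move: h1 h2 h3 h4 hs;
  case: (q 0%N \in t); case: (q 1%N \in t); case: (q 2%N \in t); by case: (q 3%N \in t).
have := nadj 0%N 1%N isT isT; have := nadj 1%N 2%N isT isT.
have := nadj 2%N 3%N isT isT; have := nadj 3%N 4%N isT isT.
have := nadj 4%N 5%N isT isT; have := nadj 0%N 5%N isT isT => h1 h2 h3 h4 h5 h6 hs.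
exists (q 0%N \in t); case=> [|[|[|[|[|[|//]]]]]] _;
move: h1 h2 h3 h4 h5 h6 hs;
case: (q 0%N \in t); case: (q 1%N \in t); case: (q 2%N \in t); case: (q 3%N \in t);
case: (q 4%N \in t); by case: (q 5%N \in t).
Qed.

Lemma enum_inner N k (Q : {set 'I_N}) q (P : pred 'I_N) b :
  enumerates (2 * k) Q q ->
  (forall i, (i < 2 * k)%N -> P (q i) = odd i (+) b) ->
  inner k Q [set x in Q | P x]%SET.
Proof.
move=> enQ Pq; apply/and3P; split.
- by apply/fintype.subsetP => x; rewrite inE => /andP[].
- have [_ _ _ ->] := enQ; rewrite (eq_bigr (fun i : 'I_(2 * k) => (odd i (+) b)%:R%N)).
    elim: k {enQ Pq} => [|k IHk]; first by rewrite big_ord0.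
    rewrite mulnS addnC addn2 !big_ord_recr /= (eqP IHk).
    by rewrite mul2n odd_double /=; case: b {IHk}; apply/eqP; lia.
  by move=> i _; rewrite Pq //; case: (_ (+) _).
- have [_ _ memQ _] := enQ.
  apply/fintype.subsetP => d /chordsP[x [y [xy xt yt ->]]].
  rewrite inE in xt; rewrite inE in yt.
  move: xt yt xy => /andP[/memQ[i im ->] Pi] /andP[/memQ[j jm ->] Pj].
  rewrite (enum_lt enQ) // => ij.
  rewrite (enum_diagonals enQ); last by lia.
  move: Pi Pj; rewrite !Pq //; case: b {Pq} => /=; rewrite ?addbT ?addbF; lia.
Qed.

(* W i j is the determinant of the i-th and j-th vertices of a piece; the     *)
(* vertices of parity b are those of its inner diagonal or triangle.          *)
Lemma plucker_values k (W : nat -> nat -> int) b : k = 2%N \/ k = 3%N ->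
  (forall i j l m, (i < j)%N -> (j < l)%N -> (l < m < 2 * k)%N ->
     W i l * W j m = W i j * W l m + W j l * W i m) ->
  (forall i, (i.+1 < 2 * k)%N -> W i i.+1 = 1) ->
  W 0%N (2 * k).-1 = 1 ->
  (forall i j, (i < j < 2 * k)%N -> odd i = b -> odd j = b -> W i j = 1) ->
  forall i j, (i < j < 2 * k)%N ->
    (odd i != b -> odd j != b -> W i j = k%:Z) /\
    (odd i != odd j -> (i.+1 < j)%N -> (j - i < (2 * k).-1)%N -> W i j = 2%:Z).
Proof.
move=> hk P S S0 I i j /andP[ij jk].
have next i' j' : j' = i'.+1 -> (j' < 2 * k)%N -> W i' j' = 1.
  by move=> -> ?; apply: S.
case: hk => ? in P S S0 I ij jk next *; subst k.
  have W01 := S 0%N isT; have W12 := S 1%N isT; have W23 := S 2%N isT.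
  have := P 0%N 1%N 2%N 3%N isT isT isT; rewrite W01 W12 W23 S0.
  case: b I => I.
    have := I 1%N 3%N isT erefl erefl => ->; rewrite mulr1 => W02.
    by case: i ij => [|[|[|[|]]]] //; case: j jk => [|[|[|[|]]]].
  have := I 0%N 2%N isT erefl erefl => ->; rewrite mul1r => W13.
  by case: i ij => [|[|[|[|]]]] //; case: j jk => [|[|[|[|]]]].
have W01 := S 0%N isT; have W12 := S 1%N isT; have W23 := S 2%N isT.
have W34 := S 3%N isT; have W45 := S 4%N isT.
have {}S0 : W 0%N 5%N = 1 := S0.
(* In the hexagon, the two ends of a long diagonal see two inner vertices along unit chords, so its
   length is 1 + 1 = 2; a short chord between outer vertices then gets 1 + 2 = 3. *)
case: b I => I.
  have W13 := I 1%N 3%N isT erefl erefl; have W35 := I 3%N 5%N isT erefl erefl.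
  have W15 := I 1%N 5%N isT erefl erefl.
  have W14 : W 1%N 4%N = 2 by have := P 1%N 3%N 4%N 5%N isT isT isT; lia.
  have W03 : W 0%N 3%N = 2 by have := P 0%N 1%N 3%N 5%N isT isT isT; lia.
  have W25 : W 2%N 5%N = 2 by have := P 1%N 2%N 3%N 5%N isT isT isT; lia.
  have W02 : W 0%N 2%N = 3 by have := P 0%N 1%N 2%N 3%N isT isT isT; lia.
  have W24 : W 2%N 4%N = 3 by have := P 1%N 2%N 3%N 4%N isT isT isT; lia.
  have W04 : W 0%N 4%N = 3 by have := P 0%N 3%N 4%N 5%N isT isT isT; lia.
  by case: i ij => [|[|[|[|[|[|]]]]]] //; case: j jk => [|[|[|[|[|[|]]]]]].
have W02 := I 0%N 2%N isT erefl erefl; have W24 := I 2%N 4%N isT erefl erefl.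
have W04 := I 0%N 4%N isT erefl erefl.
have W03 : W 0%N 3%N = 2 by have := P 0%N 2%N 3%N 4%N isT isT isT; lia.
have W14 : W 1%N 4%N = 2 by have := P 0%N 1%N 2%N 4%N isT isT isT; lia.
have W25 : W 2%N 5%N = 2 by have := P 0%N 2%N 4%N 5%N isT isT isT; lia.
have W13 : W 1%N 3%N = 3 by have := P 0%N 1%N 2%N 3%N isT isT isT; lia.
have W35 : W 3%N 5%N = 3 by have := P 2%N 3%N 4%N 5%N isT isT isT; lia.
have W15 : W 1%N 5%N = 3 by have := P 0%N 1%N 2%N 5%N isT isT isT; lia.
by case: i ij => [|[|[|[|[|[|]]]]]] //; case: j jk => [|[|[|[|[|[|]]]]]].
Qed.

(** * Determinants in the Farey graph *)

Definition fdet (x y : farey) : int := fnum x * fden y - fnum y * fden x.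

(** Denominators are never negative, so the sign of the determinant records the order in which
    infinity is greatest. *)
Lemma fdet_gt0 x y : (0 < fdet x y) = farey_gt x y.
Proof.
rewrite /fdet; case: x y => [p|] [q|] /=.
- by rewrite subr_gt0 -lt_ratE.
- by have := denq_gt0 p; lia.
- by have := denq_gt0 q; lia.
- by [].
Qed.

Lemma fdet_plucker x y z t :
  fdet x z * fdet y t = fdet x y * fdet z t + fdet y z * fdet x t.
Proof. by rewrite /fdet; ring. Qed.

Lemma farey_edge_det x y : farey_gt x y -> farey_edge x y = (fdet x y == 1).
Proof.
rewrite -fdet_gt0 /farey_edge -/(fdet x y) => xy.
by rewrite gtr0_norm.
Qed.

Lemma fcoprime x : coprimez (fnum x) (fden x).
Proof. by case: x => [q|] //=; exact: coprime_num_den. Qed.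

(** Divisibility by [m] says that two vectors are parallel modulo [m]. Both coordinates of [y] times
    [fdet x z] are combinations of the two given determinants, and a Bézout relation for the
    primitive vector [y] removes the coordinates. *)
Lemma dvdz_fdet_trans (m : int) x y z :
  (m %| fdet x y)%Z -> (m %| fdet y z)%Z -> (m %| fdet x z)%Z.
Proof.
move=> /dvdzP[r xy] /dvdzP[s yz]; have /coprimezP[[u v] /= uv] := fcoprime y.
apply/dvdzP; exists (u * (fnum x * s + fnum z * r) + v * (fden x * s + fden z * r)).
have num_y : fnum y * fdet x z = fnum x * fdet y z + fnum z * fdet x y.
  by rewrite /fdet; ring.
have den_y : fden y * fdet x z = fden x * fdet y z + fden z * fdet x y.
  by rewrite /fdet; ring.
rewrite -[LHS]mul1r -uv mulrDl -!mulrA num_y den_y xy yz; ring.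
Qed.

Lemma fdetC x y : fdet y x = - fdet x y.
Proof. by rewrite /fdet; ring. Qed.

Definition fscale (lam : rat) (x : farey) : farey :=
  if x is Some q then Some (lam * q) else None.

Lemma fscale_frac lam p (a b : int) : coprimez a b -> 0 < b ->
  a%:~R * (denq p)%:~R = lam * b%:~R * (numq p)%:~R ->
  numq (lam * p) = a /\ denq (lam * p) = b.
Proof.
move=> ab b0 abE; have -> : lam * p = a%:~R / b%:~R.
  have b_neq0 : b%:~R != 0 :> rat by rewrite intr_eq0 gt_eqF.
  have d_neq0 : (denq p)%:~R != 0 :> rat by rewrite intr_eq0 denq_neq0.
  rewrite -{1}[p]divq_num_den; apply: (mulIf d_neq0); apply: (mulIf b_neq0).
  have -> : lam * ((numq p)%:~R / (denq p)%:~R) * (denq p)%:~R * b%:~R =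
            lam * b%:~R * (numq p)%:~R by field.
  by rewrite -abE; field.
rewrite coprimeq_num // coprimeq_den //.
by rewrite gtr0_sg // mul1r (gt_eqF b0) gtr0_norm.
Qed.

(** * Clockwise paths that start at infinity *)

Section Paths.

Variables (n : nat) (v : 'I_n.+1 -> farey).
Implicit Types i j a b c e : 'I_n.+1.
Hypotheses (path_v : simple_closed_clockwise_path v) (v0 : v ord0 = None).

(** Starting at infinity, the greatest element, turns the cyclic order into a linear one. *)
Lemma path_gt i j : (i < j)%N -> farey_gt (v i) (v j).
Proof.
have [inj_v _ cw] := path_v; move=> ij.
have [i0|i0] := posnP i.
  have -> : i = ord0 by apply: val_inj.
  rewrite v0; case E: (v j) => [//|].
  have /inj_v ej : v j = v ord0 by rewrite E v0.
  by move: ij; rewrite ej.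
have := cw ord0 i j; rewrite i0 ij => /(_ isT).
rewrite /clockwise v0; case: (v i) => [p|]; case: (v j) => [q|] //=.
by rewrite ?andbF ?andbT ?orbF.
Qed.

Lemma path_det_gt0 i j : (i < j)%N -> 0 < fdet (v i) (v j).
Proof. by move=> /path_gt; rewrite fdet_gt0. Qed.

Lemma enclosed2 i j : (i < j)%N ->
  ([set i; j]%SET \in enclosed_triangulation v) =
  ([set i; j]%SET \in diagonals [set: 'I_n.+1]%SET) && (fdet (v i) (v j) == 1).
Proof.
move=> ij; rewrite inE; congr (_ && _).
have edgeC x y : farey_edge x y = farey_edge y x.
  by rewrite /farey_edge distrC.
rewrite -farey_edge_det ?path_gt //.
apply/forall_inP/idP => [h|ed x].
  have /forall_inP/(_ j) := h i (set21 _ _).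
  by rewrite set22 -val_eqE neq_ltn ij => /(_ isT).
rewrite !inE => xE; apply/forall_inP => y; rewrite !inE => yE; apply/implyP.
by case/orP: xE => /eqP->; case/orP: yE => /eqP->; rewrite ?eqxx // edgeC.
Qed.

Lemma path_next i j : j = i.+1 :> nat -> fdet (v i) (v j) = 1.
Proof.
move=> ji; have [_ /(_ i) + _] := path_v.
have -> : ordS i = j by apply: val_inj => /=; rewrite -ji modn_small.
by rewrite farey_edge_det ?path_gt ?ji // => /eqP.
Qed.

(** Farey edges do not cross: the Plücker relation would write 1 as a sum of two positive
    integers. *)
Lemma enclosed_cross a b c e : (a < c)%N -> (c < b)%N -> (b < e)%N ->
  fdet (v a) (v b) = 1 -> fdet (v c) (v e) = 1 -> False.
Proof.
move=> ac cb be ab1 ce1; have := fdet_plucker (v a) (v c) (v b) (v e).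
rewrite ab1 ce1.
have := path_det_gt0 ac; have := path_det_gt0 cb; have := path_det_gt0 be.
have /path_det_gt0 : (a < e)%N by lia.
by nia.
Qed.

End Paths.

(** * Multiflips *)

(** These pairs include every side of a piece ([piece_bond]), and all of them have determinant 1
    ([bond_det]). *)
Definition bond N (D : {set {set 'I_N}}) (a b : 'I_N) : bool :=
  (b == a.+1 :> nat) || gate D a b.

Lemma piece_bond N (D : {set {set 'I_N}}) Q x y : piece D Q ->
  x \in Q -> y \in Q -> (x < y)%N -> [set x; y]%SET \notin diagonals Q ->
  bond D x y.
Proof.
move=> /and3P[_ /fintype.subsetP sidesQ _] xQ yQ xy ndiag.
have := sidesQ [set x; y]%SET.
rewrite finset.in_setD ndiag mem_chords xQ yQ -val_eqE neq_ltn xy => /(_ isT).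
rewrite finset.in_setU /bond /gate => /orP[|->]; last by rewrite orbT.
rewrite finset.in_setD => /andP[+ _]; apply: contraNT.
rewrite !negb_or !negb_and => /and3P[yx _ ends].
rewrite diagonals2 // !finset.in_setT /=; apply/separates2P => //.
have ltN := ltn_ord y; split.
  have lt1 : (x.+1 < N)%N by lia.
  by exists (Ordinal lt1); rewrite ?finset.in_setT //=; lia.
have lt0 : (0 < N)%N by lia.
have lt1 : (N.-1 < N)%N by lia.
have [x0|x0] := posnP x.
  by exists (Ordinal lt1); rewrite ?finset.in_setT //=; lia.
by exists (Ordinal lt0); rewrite ?finset.in_setT //=; lia.
Qed.

Lemma ltn_bracket (f : nat -> nat) m i : (f 0 <= i <= f m.+1)%N ->
  exists2 j, (j <= m)%N & (f j <= i <= f j.+1)%N.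
Proof.
elim: m => [|m IHm] => [?|/andP[f0 fm]]; first by exists 0%N.
have [le_i|lt_i] := leqP i (f m.+1).
  by have [|j jm fj] := IHm; [rewrite f0|exists j => //; apply: leqW].
by exists m.+1 => //; rewrite fm ltnW.
Qed.

Section Multiflip.

Variables (n k : nat) (T D : {set {set 'I_n.+3}}) (v : 'I_n.+3 -> farey).
Hypotheses (k23 : k = 2%N \/ k = 3%N) (triT : triangulation T).
Hypotheses (partD : multiflip_partition k T D).
Hypotheses (path_v : simple_closed_clockwise_path v) (norm_v : normalised v).
Hypotheses (T_v : T = enclosed_triangulation v).

Implicit Types (a b c x y z : 'I_n.+3) (Q t : {set 'I_n.+3}).

Local Notation inc := (incident k T D).
Local Notation W i j := (fdet (v i) (v j)).

Let v0 : v ord0 = None. Proof. by case: norm_v. Qed.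

Lemma noncrossing_partition : noncrossing D.
Proof.
have [/fintype.subsetP DT _ _] := partD.
have /andP[/fintype.subsetP Tdiag /forall_inP ncT] := maxsetp triT.
apply/andP; split; first by apply/fintype.subsetP => d /DT/Tdiag.
apply/forall_inP => d /DT/ncT/forall_inP ncd.
by apply/forall_inP => e /DT/ncd.
Qed.
Let ncD := noncrossing_partition.

Lemma triangulation_det a b : (a < b)%N -> [set a; b]%SET \in T -> W a b = 1.
Proof. by move=> ab; rewrite T_v (enclosed2 path_v) // => /andP[_ /eqP]. Qed.

Lemma bond_det a b : (a < b)%N -> bond D a b -> W a b = 1.
Proof.
move=> ab /or3P[/eqP|abD|/andP[/eqP a0 /eqP bN]].
- exact: path_next.
- by apply: triangulation_det => //; have [/fintype.subsetP->] := partD.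
- have -> : a = ord0 by apply: val_inj.
  have -> : b = ord_max by apply: val_inj; case: bN.
  by case: norm_v => -> ->.
Qed.

Lemma inner_incident Q t x : piece D Q -> inner k Q t -> chords t \subset T ->
  x \in t -> inc x.
Proof.
move=> pQ inQ tT xt; have /and3P[_ /eqP card_t _] := inQ.
have [y] : exists y, y \in t :\ x.
  apply/set0Pn; rewrite -card_gt0; move: card_t; rewrite (cardsD1 x t) xt.
  by rewrite add1n -ltnS => ->; case: k23 => ->.
rewrite finset.in_setD1 => /andP[yx yt].
apply/existsP; exists [set x; y]%SET; rewrite set21 andbT.
apply/bigcupP; exists Q => //; apply/bigcupP; exists t; first by rewrite inQ.
by rewrite mem_chords xt yt eq_sym.
Qed.

(** Kept as a hypothesis of [piece_geometry] so that the latter can be used inside the induction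
    that establishes alternation; [piece_alternating] discharges it afterwards. *)
Definition alternating_piece Q : Prop :=
  forall x y, x \in Q -> y \in Q -> (x < y)%N ->
    (forall z, z \in Q -> ~~ (x < z < y)%N) -> inc y = ~~ inc x.

(** The vertices of the inner diagonal or triangle in [T] are incident, and both they and the
    incident vertices alternate around [Q], so the two sets agree on [Q]. Then [plucker_values]
    applies, and the other inner set consists of the non-incident vertices. *)
Lemma piece_geometry Q : piece D Q -> alternating_piece Q ->
  exists q, [/\ enumerates (2 * k) Q q,
    forall i, (i < 2 * k)%N -> inc (q i) = odd i (+) inc (q 0%N),
    forall x y, x \in Q -> y \in Q -> (x < y)%N ->
      (~~ inc x -> ~~ inc y -> W x y = k%:Z) /\
      (inc x != inc y -> [set x; y]%SET \in diagonals Q -> W x y = 2%:Z)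
  & forall t, inner k Q t -> ~~ (chords t \subset T) ->
      forall x, x \in t -> ~~ inc x].
Proof.
move=> pQ altQ; have [_ /(_ Q pQ)[cardQ [t0 in_t0 t0T]] _] := partD.
have k0 : (1 < k)%N by case: k23 => ->.
have [q enQ] : exists q, enumerates (2 * k) Q q.
  have -> : (2 * k)%N = (2 * k).-1.+1 by lia.
  by apply: enumerate; lia.
have [_ qQ memQ _] := enQ.
have qlt := enum_lt enQ.
have inc_q i : (i < 2 * k)%N -> inc (q i) = odd i (+) inc (q 0%N).
  elim: i => [|i IHi] ik; first by rewrite addFb.
  have -> : inc (q i.+1) = ~~ inc (q i).
    have ik' := ltnW ik.
    apply: altQ; rewrite ?qQ ?qlt // => z /memQ[j jk ->].
    by rewrite !qlt //; clear; lia.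
  by rewrite IHi ?(ltnW ik) //= addNb.
have [b t0_q] := inner_enum k23 enQ in_t0.
have inc0 : inc (q 0%N) = b.
  case: b t0_q => t0_q.
    by apply: (inner_incident pQ in_t0 t0T); rewrite t0_q //; lia.
  have : inc (q 1%N).
    by apply: (inner_incident pQ in_t0 t0T); rewrite t0_q //; lia.
  by rewrite inc_q /=; [case: (inc _)|lia].
have inc_qb i : (i < 2 * k)%N -> inc (q i) = odd i (+) b.
  by rewrite -inc0; apply: inc_q.
exists q; split=> //.
(* The parity is [~~ b] because [q i] belongs to [t0] when [odd i (+) b] holds, that is, when
   [odd i = ~~ b]. *)
- have vals := plucker_values (W := fun i j => W (q i) (q j)) (b := ~~ b) k23.
  have {}vals : forall i j, (i < j < 2 * k)%N ->
    (odd i != ~~ b -> odd j != ~~ b -> W (q i) (q j) = k%:Z) /\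
    (odd i != odd j -> (i.+1 < j)%N -> (j - i < (2 * k).-1)%N ->
       W (q i) (q j) = 2%:Z).
    apply: vals => [i j l m ij jl lmk|i ik||i j ijk ib jb].
    + exact: fdet_plucker.
    + have ik' := ltnW ik; apply: bond_det; rewrite ?qlt //.
      apply: (piece_bond pQ); rewrite ?qQ ?qlt ?(enum_diagonals enQ) ?leqnn ?ik //.
      by rewrite ltnn.
    + have [k1 k2 k3] : [/\ (0 < 2 * k)%N, ((2 * k).-1 < 2 * k)%N & (0 < (2 * k).-1)%N].
        by split; clear -k0; lia.
      apply: bond_det; rewrite ?qlt //; apply: (piece_bond pQ); rewrite ?qQ ?qlt //.
      by rewrite (enum_diagonals enQ) ?k3 // subn0 ltnn andbF.
    + have [ij ik jk] : [/\ (i < j)%N, (i < 2 * k)%N & (j < 2 * k)%N].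
        by split; clear -ijk; lia.
      have qij : (q i < q j)%N by rewrite qlt.
      apply: triangulation_det => //; apply: (fintype.subsetP t0T).
      by rewrite mem_chords !t0_q // ib jb -val_eqE neq_ltn qij; case: (b).
  move=> x y /memQ[i ik ->] /memQ[j jk ->]; rewrite qlt // => ij.
  have [|vk v2] := vals i j; first by rewrite ij.
  rewrite (enum_diagonals enQ) ?ij // !inc_qb //.
  split=> [ni nj|nij /andP[ij1 ij2]].
    by apply: vk; [move: ni|move: nj]; case: (odd _); case: (b).
  by apply: v2 => //; move: nij; case: (b); case: (odd i); case: (odd j).
- move=> t int ntT x xt; have [b' t_q] := inner_enum k23 enQ int.
  have tQ : t \subset Q by case/and3P: int.
  have t0Q : t0 \subset Q by case/and3P: in_t0.
  have [i ik xE] := memQ _ (fintype.subsetP tQ _ xt).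
  have neq : b' != b.
    apply: contraNneq ntT => eb; suff -> : t = t0 by [].
    apply/setP => y; have [/memQ[j jk ->]|yQ] := boolP (y \in Q).
      by rewrite t_q // t0_q // eb.
    by rewrite (contraNF (fintype.subsetP tQ y) yQ) (contraNF (fintype.subsetP t0Q y) yQ).
  by move: xt neq; rewrite xE t_q // inc_qb //; case: (odd i); case: (b); case: b' {t_q}.
Qed.

(* Induction on b - a, through the piece below {a, b}. *)
Lemma bond_alternate m a b : (a < b)%N -> (b - a <= m)%N -> bond D a b ->
  inc b = ~~ inc a /\
  forall i c : 'I_n.+3, (a <= i <= b)%N -> ~~ inc i -> (c == a) || (c == b) -> ~~ inc c ->
    (k%:Z %| W i c)%Z.
Proof.
elim: m a b => [|m IHm] a b ab bam bond_ab; first by lia.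
have self x : W x x = 0 by rewrite /fdet subrr.
(* On a step of the polygon exactly one end is non-incident, so [i] and [c] coincide and their
   determinant is 0. *)
have [ba|ba] := eqVneq (val b) a.+1.
  have incb : inc b = ~~ inc a.
    have [_ _ <-] := partD; congr (inc _); apply: val_inj => /=.
    by rewrite -ba modn_small ?ltn_ord.
  split=> // i c iab ninc_i cab ninc_c.
  have [ia|ib] : i = a \/ i = b.
    have [<-|] := eqVneq i a; [by left|rewrite -val_eqE /= => ia].
    by right; apply: val_inj => /=; move: ba ia iab => /=; clear; lia.
    move: incb ninc_i ninc_c; case/orP: cab => /eqP->; rewrite ia ?self ?dvdz0 //.
    by move=> ->; case: (inc a).
  move: incb ninc_i ninc_c; case/orP: cab => /eqP->; rewrite ib ?self ?dvdz0 //.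
  by move=> ->; case: (inc a).
have gab : gate D a b by move: bond_ab; rewrite /bond; move: ba => /= /negPf->.
have pQ : piece D (piece_below D a b).
  by apply: piece_piece_below => //; move: ba => /=; lia.
have /andP[aQ bQ] := @piece_below_ends _ D a b (ltnW ab).
set Q := piece_below D a b in pQ aQ bQ.
have nextQ x y : x \in Q -> y \in Q -> (x < y)%N ->
    (forall z, z \in Q -> ~~ (x < z < y)%N) -> (y - x <= m)%N /\ bond D x y.
  move=> xQ yQ xy gap; split.
    have [/andP[ax _] _] := piece_belowP _ _ _ _ xQ.
    have [/andP[_ yb] _] := piece_belowP _ _ _ _ yQ.
    have [yx|[_]] := piece_below_next ncD xQ yQ xy gap.
      by move: ba bam ab => /=; rewrite yx; clear; lia.
    by rewrite xpair_eqE -!val_eqE /=; clear -ax yb bam xy; lia.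
  apply: (piece_bond pQ) => //; apply/negP; rewrite diagonals2 // => /and3P[_ _].
  by move/(separates2P _ xy) => [[z zQ zxy] _]; have := gap z zQ; rewrite zxy.
have altQ : alternating_piece Q.
  move=> x y xQ yQ xy gap; have [yxm bxy] := nextQ x y xQ yQ xy gap.
  by case: (IHm x y xy yxm bxy).
have [q [enQ inc_q vals _]] := piece_geometry pQ altQ.
have k0 : (1 < k)%N by case: k23 => ->.
have [_ qQ memQ _] := enQ; have qlt := enum_lt enQ.
have qab l : (l < 2 * k)%N -> (a <= q l <= b)%N.
  by move=> lk; have [] := piece_belowP _ _ _ _ (qQ l lk).
have [k1 k2] : (0 < 2 * k)%N /\ ((2 * k).-1 < 2 * k)%N by clear -k0; lia.
have q0 : q 0%N = a.
  have [l lk al] := memQ _ aQ; have /andP[+ _] := qab 0%N k1.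
  rewrite leq_eqVlt => /orP[/eqP aq|]; first by apply: val_inj.
  by rewrite al qlt.
have qmax : q (2 * k).-1 = b.
  have [l lk bl] := memQ _ bQ; have /andP[_] := qab _ k2.
  rewrite leq_eqVlt => /orP[/eqP qb|]; first by apply: val_inj.
  by rewrite {1}bl qlt // -ltnS prednK // ltnNge lk.
split.
  (* The gate joins the first and last of the [2 * k] vertices, whose indices differ by an odd
     number. *)
  rewrite -qmax inc_q // q0.
  have -> : odd (2 * k).-1 by clear -k0; lia.
  by rewrite addTb.
move=> i c iab ninc_i cab ninc_c.
have [l lk qli] : exists2 l, (l <= (2 * k).-2)%N & (q l <= i <= q l.+1)%N.
  apply: (ltn_bracket (f := fun l => q l)).
  have -> : (2 * k).-2.+1 = (2 * k).-1 by clear -k0; lia.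
  by rewrite q0 qmax.
have [lk1 lk2] : (l < 2 * k)%N /\ (l.+1 < 2 * k)%N.
  by split; clear -k0 lk; lia.
have qll : (q l < q l.+1)%N by rewrite qlt.
have [ml bl] : (q l.+1 - q l <= m)%N /\ bond D (q l) (q l.+1).
  apply: nextQ; rewrite ?qQ // => z /memQ[p pk ->]; rewrite !qlt //.
  by clear; lia.
have [inc_l dvd_l] := IHm _ _ qll ml bl.
(* The vertex [i] lies below the side from [q l] to [q l.+1]; its non-incident end serves as [e].
   Since [e] and [c] are non-incident in the same piece, their determinant is 0 or [k] up to sign,
   and transitivity concludes. *)
have [e [eQ ninc_e dvd_ie]] : exists e, [/\ e \in Q, ~~ inc e & (k%:Z %| W i e)%Z].
  have [incq|nincq] := boolP (inc (q l)).
    have nincq1 : ~~ inc (q l.+1) by rewrite inc_l incq.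
    by exists (q l.+1); split; rewrite ?qQ // dvd_l ?eqxx ?orbT.
  by exists (q l); split; rewrite ?qQ // dvd_l ?eqxx.
apply: dvdz_fdet_trans dvd_ie _.
have cQ : c \in Q by case/orP: cab => /eqP->.
have [ec|ce|ec] := ltngtP e c.
- by have [vk _] := vals e c eQ cQ ec; rewrite vk ?dvdzz.
- by rewrite fdetC rpredN; have [vk _] := vals c e cQ eQ ce; rewrite vk ?dvdzz.
- by rewrite (val_inj ec) self dvdz0.
Qed.

Lemma piece_alternating Q : piece D Q -> alternating_piece Q.
Proof.
move=> pQ x y xQ yQ xy gap.
have bxy : bond D x y.
  apply: (piece_bond pQ) => //; apply/negP; rewrite diagonals2 // => /and3P[_ _].
  by move/(separates2P _ xy) => [[z zQ zxy] _]; have := gap z zQ; rewrite zxy.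
by have [] := bond_alternate xy (leqnn _) bxy.
Qed.

(** * Divisibility of numerators and denominators by [k] *)

Lemma incident_parity i : inc i = odd i (+) inc ord0.
Proof.
case: i; elim=> [|i IHi] lti; first by congr (inc _); apply: val_inj.
have lti' : (i < n.+3)%N by apply: ltnW.
have {1}-> : Ordinal lti = ordS (Ordinal lti').
  by apply: val_inj; rewrite /= modn_small.
by have [_ _ ->] := partD; rewrite IHi /= addNb.
Qed.

Lemma incident_max : inc ord_max = ~~ inc ord0.
Proof.
have [_ _ alt] := partD; rewrite -[LHS]negbK -alt; congr (~~ inc _).
by apply: val_inj; rewrite /= modnn.
Qed.

(** The whole polygon lies below the closing side from infinity to 0. Whichever of these two ends is
    non-incident has determinant with [v x] equal, up to sign, to the denominator, respectively the
    numerator. *)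
Lemma nonincident_dvd x : ~~ inc x ->
  if inc ord0 then (k%:Z %| fnum (v x))%Z else (k%:Z %| fden (v x))%Z.
Proof.
move=> ninc_x; have bond0 : bond D ord0 ord_max by rewrite /bond /gate /= eqxx !orbT.
have [_ dvd_x] := @bond_alternate _ ord0 ord_max isT (leqnn _) bond0.
have xle : (@ord0 n.+2 <= x <= @ord_max n.+2)%N by rewrite /= -ltnS.
have [inc0|ninc0] := ifPn; last first.
  have := dvd_x x ord0 xle ninc_x isT ninc0.
  by rewrite v0 /fdet /= mulr0 mul1r sub0r rpredN.
have := dvd_x x ord_max xle ninc_x; rewrite incident_max inc0 eqxx orbT.
move=> /(_ isT isT).
by have [_ ->] := norm_v; rewrite /fdet /= mulr1 mul0r subr0.
Qed.

(** The next vertex is non-incident, so the determinant ±1 with it is a Bézout relation between [k]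
    and the coordinate in question. *)
Lemma incident_coprime x : inc x ->
  if inc ord0 then coprimez k%:Z (fnum (v x)) else coprimez k%:Z (fden (v x)).
Proof.
move=> inc_x; pose y := ordS x.
have ninc_y : ~~ inc y by have [_ _ ->] := partD; rewrite inc_x.
have [_ /(_ x) + _] := path_v; rewrite -/y /farey_edge -/(fdet _ _).
move=> /eqP det1; have := nonincident_dvd ninc_y.
case: ifP => _ /dvdzP[r rE]; apply/coprimezP.
  have [e|e] : W x y = 1 \/ W x y = -1 by lia.
    exists (- r * fden (v x), fden (v y)) => /=.
    by rewrite -e /fdet rE; ring.
  exists (r * fden (v x), - fden (v y)) => /=.
  by rewrite -[RHS]opprK -e /fdet rE; ring.
have [e|e] : W x y = 1 \/ W x y = -1 by lia.
  exists (fnum (v x) * r, - fnum (v y)) => /=.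
  by rewrite -e /fdet rE; ring.
exists (- fnum (v x) * r, fnum (v y)) => /=.
by rewrite -[RHS]opprK -e /fdet rE; ring.
Qed.

(** * The scaled path *)

Definition flip_scale : rat := if inc ord0 then k%:R^-1 else k%:R.

(** The factor that makes the vector (scale · num, den) integral and primitive. *)
Definition flip_weight x : rat := if odd x then 1 else flip_scale^-1.

Definition flip_path x : farey := fscale flip_scale (v x).

Lemma k_neq0 : k%:R != 0 :> rat.
Proof. by case: k23 => ->. Qed.

Lemma flip_scale_gt0 : 0 < flip_scale.
Proof. by rewrite /flip_scale; case: k23 => ->; case: ifP. Qed.

(** Four cases, by the parity of the label and by whether infinity is incident. At incident vertices
    a coordinate is multiplied by [k], and [incident_coprime] keeps the fraction reduced; at
    non-incident ones a coordinate is divided by [k], which [nonincident_dvd] permits. *)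
Lemma flip_fraction x :
  (fnum (flip_path x))%:~R = flip_scale * flip_weight x * (fnum (v x))%:~R /\
  (fden (flip_path x))%:~R = flip_weight x * (fden (v x))%:~R.
Proof.
have k0 : 0 < k%:Z by case: k23 => ->.
have kn0 : k%:R != 0 :> rat := k_neq0.
have kE : k%:Z%:~R = k%:R :> rat by [].
have := nonincident_dvd (x := x); have := incident_coprime (x := x).
rewrite /flip_path /flip_weight /flip_scale incident_parity.
have vx : odd x -> v x != None.
  have [inj_v _ _] := path_v; move=> ox; apply/eqP; rewrite -v0 => /inj_v ex.
  by rewrite ex in ox.
case: (v x) vx => [p|]; last first.
  move=> /(_ _)/negP; case: (odd x) => [/(_ isT)//|_ _ _] /=.
  by rewrite mulr0 mulr1; case: ifP => _; rewrite ?invrK ?mulVf ?mulfV.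
move=> _; have d0 := denq_gt0 p; have cop : coprimez (numq p) (denq p) := fcoprime (Some p).
rewrite [fscale _ _]/= [fnum (Some _)]/= [fden (Some _)]/=.
have [inc0|ninc0] := ifPn; case: ifPn => [ox|ex] /=.
- move=> _ /(_ isT) /dvdzP[r rE]; move: cop; rewrite rE coprimezMl => /andP[cop _].
  have [|-> ->] := @fscale_frac k%:R^-1 p r (denq p) cop d0.
    by rewrite ?rE intrM kE; field.
  by rewrite ?rE intrM kE; split; field.
- move=> /(_ isT) cop_k _.
  have [|||-> ->] := @fscale_frac k%:R^-1 p (numq p) (k%:Z * denq p).
  + by rewrite coprimezMr cop coprimez_sym cop_k.
  + exact: mulr_gt0.
  + by rewrite intrM kE; field.
  by rewrite intrM kE; split; field.
- move=> /(_ isT) cop_k _.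
  have [|//||-> ->] := @fscale_frac k%:R p (k%:Z * numq p) (denq p).
  + by rewrite coprimezMl cop cop_k.
  + by rewrite intrM kE; ring.
  by rewrite intrM kE; split; ring.
- move=> _ /(_ isT) /dvdzP[r rE]; move: cop d0; rewrite rE coprimezMr.
  rewrite pmulr_lgt0 // => /andP[cop _] r0.
  have [|-> ->] := @fscale_frac k%:R p (numq p) r cop r0.
    by rewrite ?rE intrM kE; ring.
  by rewrite ?rE intrM kE; split; field.
Qed.

Local Notation W' i j := (fdet (flip_path i) (flip_path j)).

Lemma flip_det x y :
  (W' x y)%:~R = flip_scale * flip_weight x * flip_weight y * (W x y)%:~R :> rat.
Proof.
have [nx dx] := flip_fraction x; have [ny dy] := flip_fraction y.
by rewrite /fdet !intrB !intrM nx dx ny dy; ring.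
Qed.

Lemma flip_det_mixed x y : inc x != inc y -> W' x y = W x y.
Proof.
rewrite (incident_parity x) (incident_parity y) => xy; apply: (@intr_inj rat); rewrite flip_det.
have s0 : flip_scale != 0 by rewrite gt_eqF ?flip_scale_gt0.
move: xy; rewrite /flip_weight; case: (odd x); case: (odd y); case: (inc _) => // _;
by rewrite ?mulr1 mulfV // mul1r.
Qed.

Lemma flip_det_incident x y : inc x -> inc y -> W' x y = k%:Z * W x y.
Proof.
rewrite (incident_parity x) (incident_parity y) => ix iy; apply: (@intr_inj rat).
rewrite flip_det /flip_weight /flip_scale intrM; have := k_neq0.
by move: ix iy; case: (odd x); case: (odd y); case: (inc _) => //= _ _ k0; field.
Qed.

Lemma flip_det_nonincident x y : ~~ inc x -> ~~ inc y -> k%:Z * W' x y = W x y.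
Proof.
rewrite (incident_parity x) (incident_parity y) => ix iy; apply: (@intr_inj rat).
rewrite intrM flip_det /flip_weight /flip_scale; have := k_neq0.
by move: ix iy; case: (odd x); case: (odd y); case: (inc _) => //= _ _ k0; field.
Qed.

Lemma flip_path_normalised : normalised flip_path.
Proof.
by case: norm_v => e0 em; split; rewrite /flip_path ?e0 ?em //= mulr0.
Qed.

(** Consecutive vertices form mixed pairs, whose determinants do not change, and a positive factor
    preserves the order. *)
Lemma flip_path_simple : simple_closed_clockwise_path flip_path.
Proof.
have [inj_v edge_v cw_v] := path_v; have s0 := flip_scale_gt0; split.
- move=> x y; rewrite /flip_path /fscale => exy; apply: inj_v; move: exy.
  case: (v x) => [p|]; case: (v y) => [q|] //= [].
  by move/(mulfI (lt0r_neq0 s0)) ->.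
- move=> x; have := edge_v x; rewrite /farey_edge -!/(fdet _ _) flip_det_mixed //.
  by have [_ _ ->] := partD; case: (inc x).
- move=> x y z /cw_v; rewrite /clockwise.
  suff gtE a b : farey_gt (flip_path a) (flip_path b) = farey_gt (v a) (v b).
    by rewrite !gtE.
  by rewrite /flip_path; case: (v a) => [p|]; case: (v b) => [q|] //=; rewrite ltr_pM2l.
Qed.

Lemma multiflip_enclosed : multiflip k T D = enclosed_triangulation flip_path.
Proof.
have p'v := flip_path_simple; have [v'0 _] := flip_path_normalised.
have k1 : (1 < k)%N by case: k23 => ->.
have DT : D \subset T by case: partD.
have Tdiag : T \subset diagonals [set: 'I_n.+3]%SET.
  by have /andP[] := maxsetp triT.
apply/setP => d; apply/idP/idP.
  rewrite /multiflip finset.in_setU => /orP[dD|].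
    have dT := fintype.subsetP DT _ dD; have ddiag := fintype.subsetP Tdiag _ dT.
    have /chordsP[x [y [xy _ _ dE]]] := fintype.subsetP (diagonals_sub _) _ ddiag.
    rewrite dE in dD dT ddiag *; rewrite (enclosed2 p'v) // ddiag /=.
    have bxy : bond D x y by rewrite /bond /gate dD orbT.
    have [incy _] := bond_alternate xy (leqnn _) bxy.
    rewrite flip_det_mixed; last by rewrite incy; case: (inc x).
    by apply/eqP; apply: triangulation_det.
  move=> /bigcupP[Q pQ /bigcupP[t /andP[int ntT] dt]].
  have [q [_ _ vals nt]] := piece_geometry pQ (piece_alternating pQ).
  have /and3P[tQ _ /fintype.subsetP/(_ d dt) dQ] := int.
  have /chordsP[x [y [xy xt yt dE]]] := dt.
  rewrite dE in dQ *; rewrite (enclosed2 p'v) //.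
  rewrite (fintype.subsetP (diagonals_mono (finset.subsetT Q)) _ dQ) /=.
  have nx := nt t int ntT x xt; have ny := nt t int ntT y yt.
  have [xQ yQ] : x \in Q /\ y \in Q by rewrite !(fintype.subsetP tQ).
  (* A flipped chord joins non-incident vertices, so its determinant drops from [k] to 1. *)
  have [Wk _] := vals x y xQ yQ xy.
  have := flip_det_nonincident nx ny; rewrite Wk // => /eqP.
  by rewrite -{2}[k%:Z]mulr1 (inj_eq (mulfI _)) //; case: k23 => ->.
move=> d_enc.
have ddiag : d \in diagonals [set: 'I_n.+3]%SET by move: d_enc; rewrite inE => /andP[].
have /chordsP[x [y [xy _ _ dE]]] := fintype.subsetP (diagonals_sub _) _ ddiag.
rewrite dE in d_enc ddiag *.
have W'1 : W' x y = 1 by move: d_enc; rewrite (enclosed2 p'v) // => /andP[_ /eqP].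
have D'1 a b : (a < b)%N -> [set a; b]%SET \in D -> W' a b = 1.
  move=> ab abD; have bab : bond D a b by rewrite /bond /gate abD orbT.
  have [incb _] := bond_alternate ab (leqnn _) bab.
  rewrite flip_det_mixed; last by rewrite incb; case: (inc a).
  exact: bond_det.
rewrite /multiflip finset.in_setU.
(* The cuts are still Farey edges of the scaled path, so the given edge cannot cross them. *)
have [a b abD|->//|[Q pQ dQ]] := diagonal_in_piece ncD ddiag xy.
  split; apply/negP => /andP[/andP[h1 h2] h3].
    by apply: (enclosed_cross p'v v'0 h1 h2 h3 _ W'1); apply: D'1 => //; apply: ltn_trans h2.
  by apply: (enclosed_cross p'v v'0 h1 h2 h3 W'1); apply: D'1 => //; apply: ltn_trans h3.
apply/orP; right.
have [q [enQ inc_q vals _]] := piece_geometry pQ (piece_alternating pQ).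
have [xQ yQ] : x \in Q /\ y \in Q by move: dQ; rewrite diagonals2 // => /and3P[].
have [Wk W2] := vals x y xQ yQ xy.
pose t := [set z in Q | ~~ inc z]%SET.
have int : inner k Q t.
  apply: (enum_inner (b := ~~ inc (q 0%N)) enQ) => i ik.
  by rewrite inc_q // addbN.
(* Otherwise the scaled determinant would be a multiple of [k] for an incident pair, or 2 for a
   mixed diagonal of [Q]. *)
have [nx ny] : ~~ inc x /\ ~~ inc y.
  have W0 := path_det_gt0 path_v v0 xy.
  have [ix|nx] := boolP (inc x); have [iy|ny] := boolP (inc y) => //.
  - by move: W'1; rewrite flip_det_incident //; case: k23 => ->; clear -W0; lia.
  - by move: W'1; rewrite flip_det_mixed ?W2 ?ix ?(negPf ny).
  - by move: W'1; rewrite flip_det_mixed ?W2 ?iy ?(negPf nx).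
have xyt : [set x; y]%SET \in chords t.
  by rewrite mem_chords !inE xQ yQ nx ny -val_eqE neq_ltn xy.
apply/bigcupP; exists Q => //; apply/bigcupP; exists t => //.
(* Chords of [T] have determinant 1, whereas this one had [k] before scaling. *)
rewrite int /=; apply/negP => /fintype.subsetP/(_ _ xyt)/(triangulation_det xy).
by rewrite Wk //; case: k23 => ->.
Qed.

End Multiflip.

(** * Horocycles *)

Section Horocycles.

Variable R : realType.
Implicit Types (l : R) (H : horocycle R).

Definition dilate_horocycle l H : horocycle R :=
  match H with
  | HoroReal c r => HoroReal (l * c) (l * r)
  | HoroInfty h => HoroInfty (l * h)
  end.

Lemma dilate_mem l H z : 0 < l -> horo_points H z ->
  horo_points (dilate_horocycle l H) (l%:C%C * z).
Proof.
move=> l0; case: H => [c r|h]; case: z => x y /=.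
  rewrite mul0r addr0 => -[y0 zr]; split; first exact: mulr_gt0.
  have -> : l%:C%C * (x +i* y)%C - ((l * c) +i* (l * r))%C =
            l%:C%C * ((x +i* y)%C - (c +i* r)%C).
    by apply/eqP; rewrite eq_complex /=; apply/andP; split; apply/eqP; ring.
  by rewrite normrM zr ger0_norm ?ler0c ?ltW // -rmorphM.
by rewrite mul0r addr0 => ->.
Qed.

Lemma mobius_scale_horo l H : 0 < l ->
  mobius_scale l (horo_points H) = horo_points (dilate_horocycle l H).
Proof.
move=> l0; have l_neq0 : l != 0 by rewrite gt_eqF.
apply/seteqP; split=> [_ [z Hz <-]|z Hz]; first exact: dilate_mem.
have lC0 : l%:C%C != 0 by rewrite eq_complex /= eqxx andbT.
(* The reverse inclusion is the forward one for the inverse dilation. *)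
exists ((l^-1)%:C%C * z); last by rewrite fmorphV mulVKf.
have linv0 : 0 < l^-1 by rewrite invr_gt0.
have := dilate_mem linv0 Hz; congr (horo_points _ _).
by case: H {Hz} => [c r|h] /=; rewrite !mulKf.
Qed.

End Horocycles.

(* The polygon has n.+3 >= 3 vertices; in a normalised path the vertex        *)
(* infinity has label 0.                                                      *)
Theorem corollary16 (R : realType) (k n : nat) (T D : {set {set 'I_n.+3}})
    (F : 'I_n.+3 -> horocycle R) :
  k = 2%N \/ k = 3%N ->
  triangulation T ->
  multiflip_partition k T D ->
  normalised_ford_chain T F ->
  let lam : R := if incident k T D ord0 then k%:R^-1 else k%:R in
  exists2 F' : 'I_n.+3 -> horocycle R,
    normalised_ford_chain (multiflip k T D) F' &
    forall i : 'I_n.+3,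
      mobius_scale lam (horo_points (rescale_chain lam F i)) =
      horo_points (F' i).
Proof.
move=> k23 triT partD [v [path_v norm_v T_v FE]] lam.
pose v' := flip_path k T D v.
exists (fun i => ford_circle R (v' i)).
  exists v'; split=> //.
  - exact: flip_path_simple.
  - exact: flip_path_normalised.
  - exact: multiflip_enclosed.
move=> i; have lamE : lam = ratr (flip_scale k T D).
  by rewrite /lam /flip_scale; case: ifP => _; rewrite ?fmorphV rmorph_nat.
have lam0 : 0 < lam by rewrite lamE ltr0q flip_scale_gt0.
have lam_neq0 : lam != 0 by rewrite gt_eqF.
rewrite mobius_scale_horo // /rescale_chain FE; congr (horo_points _).
have [numE denE] := flip_fraction k23 triT partD path_v norm_v T_v i.
move: denE; rewrite /v' /flip_path.
case E : (v i) => [p|] /=; last first.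
  have [inj_v _ _] := path_v; have [v0 _] := norm_v.
  (* Infinity has the even label 0, so the line at height 1 moves to height 1 / [lam] and the
     dilation brings it back. *)
  have -> : i = ord0 by apply: inj_v; rewrite E v0.
  by move=> _; rewrite /= expr0 expr1z mul1r mulfV.
set den' := denq _ => denE.
have {}denE : den'%:~R = (if odd i then 1 else lam^-1) * (denq p)%:~R :> R.
  have := congr1 (ratr : rat -> R) denE.
  rewrite rmorphM /= !ratr_int => ->; rewrite /flip_weight.
  by rewrite lamE; case: ifP => _; rewrite ?rmorph1 ?fmorphV.
have d0 : (denq p)%:~R != 0 :> R by rewrite intr_eq0 denq_neq0.
rewrite denE rmorphM /= -lamE; congr HoroReal.
(* Rescaling and dilation together multiply the radius by 1 at odd labels and by the square of [lam]
   at even ones, matching the inverse square of the new denominator. *)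
rewrite -signr_odd; case: (odd i); rewrite /= ?expr0 ?expr1 ?expr1z ?exprN1; field.
all: by rewrite ?d0 ?lam_neq0.
Qed.
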